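(* Let $Y_1,\dots,Y_n\in\mathbb{R}^m$, let $p_1,\dots,p_n>0$ with $\sum_ip_i=1$, let $\|\cdot\|$ be any norm on $\mathbb{R}^m$, and let $f:\mathbb{R}^m\to\mathbb{R}$ be a cost function for which there is a constant $L$ with $|f(z)-f(Y_i)|\le L\|z-Y_i\|$ for all $z\in\mathbb{R}^m$ and $i=1,\dots,n$. For $\varepsilon\ge0$ let $$V_{\rm w}(\varepsilon)=\max_{\gamma\in\mathcal{X}}\Big\{\int f(z)\Big(\sum_{i=1}^n\gamma_i(dz)\Big)\ \Big|\ \sum_{i=1}^n\int\|z-Y_i\|\,\gamma_i(dz)\le\varepsilon\Big\},$$ where $\mathcal{X}$ is the set of $n$-tuples $\gamma=(\gamma_1,\dots,\gamma_n)$ of nonnegative measures on $\mathbb{R}^m$ with $\int\gamma_i(dz)=p_i$ for $i=1,\dots,n$. Then $$\lim_{\varepsilon\downarrow0}\frac{V_{\rm w}(\varepsilon)-V_{\rm w}(0)}{\varepsilon}=\max_{i=1,\dots,n}\ \max_{z_i\in\mathbb{R}^m}\frac{f(z_i)-f(Y_i)}{\|z_i-Y_i\|}.$$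
   Context: The function $f$ is (Borel) measurable; maxima that are not attained are understood as suprema. The ratio $\frac{f(z_i)-f(Y_i)}{\|z_i-Y_i\|}$ is taken to be $0$ when $z_i=Y_i$. The limit is the worst-case sensitivity for the type-1 Wasserstein uncertainty set around the nominal distribution $\sum_ip_i\delta_{Y_i}$, with growth function $g(\varepsilon)=\varepsilon$. *)

(* Defs.v *)
From HB Require Import structures.
From mathcomp Require Import all_boot all_order all_algebra.
From mathcomp Require Import all_classical all_reals all_analysis.

Set Implicit Arguments.
Unset Strict Implicit.
Unset Printing Implicit Defensive.

Import Order.TTheory GRing.Theory Num.Theory.
Import numFieldNormedType.Exports.

Local Open Scope classical_set_scope.
Local Open Scope ring_scope.

(* Nonnegativity follows from the three axioms, as in [Lmodule_isNormed]. *)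
Definition is_norm (R : realType) (V : lmodType R) (N : V -> R) : Prop :=
  [/\ forall x y, N (x + y) <= N x + N y,
      forall (a : R) x, N (a *: x) = `|a| * N x
    & forall x, N x = 0 -> x = 0].

(* R^m with its Borel sets. All norms on R^m induce the same topology, so the
   canonical topology of row vectors gives the Borel sets of any norm. *)
Definition borel_rV (R : realType) (m : nat) :=
  g_sigma_algebraType (@open 'rV[R]_m).
HB.instance Definition _ (R : realType) (m : nat) :=
  Measurable.on (borel_rV R m).

Section sum_measure.
Local Open Scope ereal_scope.
Context d (T : measurableType d) (R : realType) (n : nat).
Variable gamma : 'I_n -> {measure set T -> \bar R}.

Definition sum_measure (A : set T) : \bar R := \sum_(i < n) gamma i A.

Let sum_measure0 : sum_measure set0 = 0.
Proof. by rewrite /sum_measure big1. Qed.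

Let sum_measure_ge0 A : 0 <= sum_measure A.
Proof. by rewrite /sum_measure; apply: sume_ge0. Qed.

Let sum_measure_sigma_additive : semi_sigma_additive sum_measure.
Proof.
move=> F mF tF mUF; rewrite [X in _ --> X](_ : _ =
    lim ((fun n => \sum_(0 <= i < n) sum_measure (F i)) @ \oo)).
  by apply: is_cvg_ereal_nneg_natsum => k _; exact: sume_ge0.
rewrite nneseries_sum//; apply: eq_bigr => /= i _.
exact: measure_semi_bigcup.
Qed.

HB.instance Definition _ := isMeasure.Build _ _ _ sum_measure
  sum_measure0 sum_measure_ge0 sum_measure_sigma_additive.

End sum_measure.

Section worst_case.
Context (R : realType) (m n : nat).
Variables (N : 'rV[R]_m -> R) (Y : 'I_n -> 'rV[R]_m) (p : 'I_n -> R).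
Variable f : 'rV[R]_m -> R.

Definition mass_constrained :
    set ('I_n -> {measure set (borel_rV R m) -> \bar R}) :=
  [set gamma | forall i, gamma i setT = (p i)%:E].

Definition transport_cost
    (gamma : 'I_n -> {measure set (borel_rV R m) -> \bar R}) : \bar R :=
  (\sum_(i < n) \int[gamma i]_z (N (z - Y i))%:E)%E.

(* Each integral is well defined when f satisfies the growth condition and the
   transport cost is finite; the supremum is taken in the extended reals. *)
Definition Vw (eps : R) : \bar R :=
  ereal_sup [set (\int[sum_measure gamma]_z (f z)%:E)%E |
    gamma in mass_constrained `&`
             [set gamma | (transport_cost gamma <= eps%:E)%E]].

Definition slope (i : 'I_n) (z : 'rV[R]_m) : R :=
  if z == Y i then 0 else (f z - f (Y i)) / N (z - Y i).

End worst_case.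

(* Main.v *)
(* Let s be the right-hand side and V0 = sum_i p_i f(Y_i), which is Vw 0. As
   f z <= f (Y_i) + s |z - Y_i|, integration gives Vw e <= V0 + s e. Conversely,
   moving mass e / |z - Y_i| from Y_i to z costs e and gains e times the slope
   at (i, z); this is feasible once e is small, so the difference quotient is
   eventually at least any given slope. *)
Require Import Defs.
From HB Require Import structures.
From mathcomp Require Import all_boot all_order all_algebra.
From mathcomp Require Import all_classical all_reals all_analysis.
From mathcomp Require Import measurable_realfun ring lra.
Import Order.TTheory GRing.Theory Num.Theory.
Import numFieldNormedType.Exports.
Local Open Scope classical_set_scope.
Local Open Scope ring_scope.

(** * Norms on row vectors: continuity and Borel measurability *)

Section norm.
Context (R : realType) (m : nat) (N : 'rV[R]_m -> R).
Hypothesis N_norm : is_norm N.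

Lemma is_norm0 : N 0 = 0.
Proof. by have [_ NZ _] := N_norm; rewrite -(scale0r 0) NZ normr0 mul0r. Qed.

Lemma is_normN x : N (- x) = N x.
Proof. by have [_ NZ _] := N_norm; rewrite -scaleN1r NZ normrN1 mul1r. Qed.

Lemma is_norm_ge0 x : 0 <= N x.
Proof.
have [ND _ _] := N_norm; have := ND x (- x).
by rewrite subrr is_norm0 is_normN -mulr2n pmulrn_lge0.
Qed.

Lemma is_norm_gt0 x : x != 0 -> 0 < N x.
Proof.
have [_ _ N_eq0] := N_norm.
by move=> x0; rewrite lt0r is_norm_ge0 andbT; apply: contra_neq x0 => /N_eq0.
Qed.

(** Expansion in the standard basis; this is the half of the equivalence of norms that gives
    continuity of [N] in the canonical topology. *)
Lemma is_norm_le_coord x : N x <= \sum_(j < m) `|x 0 j| * N 'e_j.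
Proof.
have [ND NZ _] := N_norm; rewrite {1}[x]row_sum_delta.
elim/big_ind2: _ => [|a u b v Nu Nv|j _]; first by rewrite is_norm0.
- by apply: le_trans (ND u v) _; exact: lerD.
- by rewrite NZ.
Qed.

Lemma is_norm_dist x y : `|N x - N y| <= N (x - y).
Proof.
have [ND _ _] := N_norm.
have le u v : N u - N v <= N (u - v) by rewrite lerBlDr -{1}(subrK v u) ND.
by rewrite ler_norml le andbT lerNl opprB -(is_normN (x - y)) opprB le.
Qed.

Lemma is_norm_sub_continuous (v : 'rV[R]_m) :
  continuous (fun z : 'rV[R]_m => N (z - v)).
Proof.
move=> x; apply/(@cvgrPdist_le _ _ _ _ (nbhs_filter x)) => e e0.
(* The [+ 1] keeps [C] positive even when [m = 0]. *)
pose C := \sum_(j < m) N 'e_j + 1.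
have C0 : 0 < C by rewrite ltr_wpDl// sumr_ge0// => j _; exact: is_norm_ge0.
have : \forall y \near x, ball x (e / C) y.
  by apply: nbhsx_ballx; rewrite divr_gt0.
apply: filterS => y xy; apply: le_trans (is_norm_dist _ _) _.
rewrite opprB addrA subrK.
apply: le_trans (is_norm_le_coord _) _.
apply: (@le_trans _ _ (\sum_(j < m) (e / C) * N 'e_j)).
  apply: ler_sum => j _; rewrite ler_wpM2r ?is_norm_ge0// mxE mxE.
  have [_ /(_ 0 j) /ltW] := xy; exact.
rewrite -mulr_sumr mulrAC ler_pdivrMr// ler_wpM2l ?(ltW e0)//.
by rewrite lerDl.
Qed.

Lemma measurable_norm_sub (y : 'rV[R]_m) :
  measurable_fun [set: borel_rV R m] (fun z : borel_rV R m => N (z - y)).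
Proof.
(* Open rays generate the Borel sets of the line, and by continuity their preimages are open. *)
apply: (measurability _ (RGenOInfty.measurableE R)) => _ [_ [a ->] <-].
rewrite setTI; apply: sub_sigma_algebra.
apply: (@open_comp _ _ (fun z : 'rV[R]_m => N (z - y))).
  by move=> z _; exact: is_norm_sub_continuous.
exact: interval_open.
Qed.

End norm.

(** * Integration against a finite sum of measures *)

Section sum_measure.
Context d (T : measurableType d) (R : realType) (n : nat).
Variable gamma : 'I_n -> {measure set T -> \bar R}.

Lemma ge0_integral_sum_measure (f : T -> \bar R) :
  (forall x, 0 <= f x)%E -> measurable_fun setT f ->
  (\int[sum_measure gamma]_x f x = \sum_(i < n) \int[gamma i]_x f x)%E.
Proof.
move=> f0 mf.
(* [msum] takes a family indexed by the naturals, so [gamma] is extended by the zero measure. *)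
pose g k : {measure set T -> \bar R} := oapp gamma mzero (insub k).
have gE (i : 'I_n) : g i = gamma i by rewrite /g valK.
rewrite (eq_measure_integral (msum g n)); last first.
  by move=> A _ _; rewrite /sum_measure /msum; under [RHS]eq_bigr do rewrite gE.
rewrite ge0_integral_measure_sum//.
by under eq_bigr do rewrite gE.
Qed.

Lemma integral_sum_measure (f : T -> \bar R) :
  (forall i, (gamma i).-integrable setT f) -> measurable_fun setT f ->
  (\int[sum_measure gamma]_x f x = \sum_(i < n) \int[gamma i]_x f x)%E.
Proof.
move=> fi mf; rewrite integralE.
rewrite !ge0_integral_sum_measure//; last 2 first.
  exact: measurable_funeneg.
  exact: measurable_funepos.
(* Integrability keeps the negative parts finite, so negation distributes over their sum. *)
rewrite -fin_num_sumeN; last by move=> i _; exact: integrable_neg_fin_num.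
by rewrite -big_split/=; apply: eq_bigr => i _; rewrite [RHS]integralE.
Qed.

End sum_measure.

(** * Measures carried by two points *)

Section two_diracs.
Context d (T : measurableType d) (R : realType).
Variables (a b : {nonneg R}) (y z : T).

Definition two_diracs : {measure set T -> \bar R} :=
  measure_add (mscale a \d_y) (mscale b \d_z).

Lemma two_diracsT : two_diracs setT = (a%:num + b%:num)%:E.
Proof.
rewrite -[LHS]/(measure_add (mscale a \d_y) (mscale b \d_z) setT).
rewrite measure_addE.
by rewrite -[LHS]/(a%:num%:E * \d_y setT + b%:num%:E * \d_z setT)%E !diracT
  !mule1.
Qed.

Lemma integral_two_diracs (f : T -> R) : measurable_fun setT f ->
  (\int[two_diracs]_x (f x)%:E = (a%:num * f y + b%:num * f z)%:E)%E.
Proof.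
move=> mf.
have ge0_int (g : T -> \bar R) : (forall x, 0 <= g x)%E ->
    measurable_fun setT g ->
    (\int[two_diracs]_x g x = a%:num%:E * g y + b%:num%:E * g z)%E.
  move=> g0 mg; rewrite ge0_integral_measure_add// !ge0_integral_mscale//.
  by rewrite !integral_dirac// !diracT !mul1e.
have mF : measurable_fun setT (EFin \o f) by exact/measurable_EFinP.
rewrite integralE !ge0_int//; last 2 first.
  exact: measurable_funeneg.
  exact: measurable_funepos.
have pos x : ((EFin \o f)^\+ x = (Num.max (f x) 0)%:E)%E.
  by rewrite funeposE EFin_max.
have neg x : ((EFin \o f)^\- x = (Num.max (- f x) 0)%:E)%E.
  by rewrite funenegE EFin_max.
rewrite !pos !neg -!EFinM -!EFinD; congr EFin.
(* Eliminating the positive parts this way leaves a ring identity. *)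
have maxB r : Num.max r 0 = Num.max (- r) 0 + r :> R.
  have [r0|/ltW r0] := lerP r 0.
    by rewrite max_l ?oppr_ge0// addNr.
  by rewrite max_r ?oppr_le0// add0r.
rewrite (maxB (f y)) (maxB (f z)); ring.
Qed.

End two_diracs.

(** * Bounds on the worst-case value and its difference quotient at zero *)

Section sensitivity.
Context (R : realType) (m n : nat).
Variables (Y : 'I_n -> 'rV[R]_m) (p : 'I_n -> R).
Variables (N : 'rV[R]_m -> R) (f : 'rV[R]_m -> R).
Hypotheses (p_gt0 : forall i, 0 < p i) (N_norm : is_norm N).
Hypothesis f_meas : measurable_fun [set: borel_rV R m] (f : borel_rV R m -> R).

Let nominal := \sum_(i < n) p i * f (Y i).

Local Notation marginals := ('I_n -> {measure set (borel_rV R m) -> \bar R}).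

Lemma integral_norm_sub_ge0 (mu : {measure set (borel_rV R m) -> \bar R}) y :
  (0 <= \int[mu]_z (N (z - y))%:E)%E.
Proof. by apply: integral_ge0 => z _; rewrite lee_fin is_norm_ge0. Qed.

Lemma integrable_norm_sub (gamma : marginals) (e : R) :
  (transport_cost N Y gamma <= e%:E)%E ->
  forall i, (gamma i).-integrable [set: borel_rV R m]
    (fun z => (N (z - Y i))%:E).
Proof.
move=> cost i; apply/integrableP; split.
  apply/measurable_EFinP; exact: measurable_norm_sub.
under eq_integral => z _ do rewrite gee0_abs ?lee_fin ?is_norm_ge0//.
apply: le_lt_trans (ltry e); apply: le_trans _ cost.
rewrite /transport_cost (bigD1 i)//= leeDl// sume_ge0// => j _.
exact: integral_norm_sub_ge0.
Qed.

Lemma integrable_mass_cst (gamma : marginals) (c : R) :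
  mass_constrained p gamma ->
  forall i, (gamma i).-integrable [set: borel_rV R m] (fun=> c%:E).
Proof.
move=> mass i; apply/integrableP; split; first exact: measurable_cst.
by rewrite (integral_cst _ _ `|c%:E|%E)// [X in (_ * X)%E]mass -EFinM ltry.
Qed.

Section growth.
Variable L : R.
Hypothesis f_growth : forall z i, `|f z - f (Y i)| <= L * N (z - Y i).

(** The growth condition dominates [f] by a constant plus a multiple of the distance to [Y i];
    finite mass makes the first integrable, finite cost the second. *)
Lemma integrable_growth (gamma : marginals) (e : R) :
  mass_constrained p gamma -> (transport_cost N Y gamma <= e%:E)%E ->
  forall i, (gamma i).-integrable [set: borel_rV R m] (fun z => (f z)%:E).
Proof.
move=> mass cost i.
apply: (@le_integrable _ (borel_rV R m) _ (gamma i) setT _ _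
  (fun z => (`|f (Y i)|%:E + L%:E * (N (z - Y i))%:E)%E)) => //.
- exact/measurable_EFinP.
- move=> z _; rewrite lee_fin/=.
  apply: le_trans (ler_norm _); have := f_growth z i.
  have := ler_normD (f (Y i)) (f z - f (Y i)).
  rewrite [f (Y i) + _]addrC subrK; lra.
- apply: integrableD => //; first exact: integrable_mass_cst.
  by apply: integrableZl => //; exact: integrable_norm_sub cost i.
Qed.

(** The constant [s] is left free: [|L|] serves at [e = 0] to compute [Vw] there, and the supremum
    of the slopes serves for the limit. *)
Lemma Vw_le (s e : R) :
  0 <= s -> (forall i z, f z <= f (Y i) + s * N (z - Y i)) ->
  (Vw N Y p f e <= (nominal + s * e)%:E)%E.
Proof.
move=> s0 fs; apply: ub_ereal_sup => _ [gamma [mass cost] <-].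
have fi := integrable_growth _ _ mass cost.
have Ni := integrable_norm_sub _ _ cost.
rewrite integral_sum_measure//; last exact/measurable_EFinP.
apply: (@le_trans _ _ (\sum_(i < n) ((p i * f (Y i))%:E +
    s%:E * \int[gamma i]_z (N (z - Y i))%:E))%E).
  apply: lee_sum => i _.
  have ci := integrable_mass_cst _ (f (Y i)) mass i.
  have -> : (p i * f (Y i))%:E = (\int[gamma i]_z (f (Y i))%:E)%E.
    by rewrite (integral_cst _ _ (f (Y i))%:E)// mass -EFinM mulrC.
  rewrite -integralZl// -integralD//; last exact: integrableZl.
  apply: le_integral => //.
    by apply: integrableD => //; exact: integrableZl.
  by move=> z _; rewrite -EFinM -EFinD lee_fin.
rewrite big_split/= sumEFin EFinD leeD2l// -ge0_sume_distrr.
  by rewrite EFinM lee_wpmul2l// lee_fin.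
by move=> i _; exact: integral_norm_sub_ge0.
Qed.

(* The competitor moves mass [e / N (z - Y i)] from [Y i] to [z] and leaves the
   other atoms in place; for [z = Y i] that mass is [e / 0 = 0]. *)
Lemma Vw_ge (e : R) (i : 'I_n) (z : 'rV[R]_m) :
  0 <= e -> e / N (z - Y i) <= p i ->
  ((nominal + slope N Y f i z * e)%:E <= Vw N Y p f e)%E.
Proof.
move=> e0 ep.
pose t := e / N (z - Y i).
have t0 : 0 <= t by rewrite divr_ge0// is_norm_ge0.
pose b j := if j == i then t else 0.
have b0 j : 0 <= b j by rewrite /b; case: ifP.
have a0 j : 0 <= p j - b j.
  by rewrite /b; case: eqP => [->|_]; rewrite subr_ge0// ltW.
pose gamma : marginals := fun j =>
  @two_diracs _ (borel_rV R m) R (NngNum (a0 j)) (NngNum (b0 j)) (Y j) z.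
have sum_b (g : 'I_n -> R) : \sum_j b j * g j = t * g i.
  rewrite (bigD1 i)//= /b eqxx big1 ?addr0// => j /negbTE ->.
  by rewrite mul0r.
have mass : mass_constrained p gamma.
  by move=> j; rewrite /gamma two_diracsT/= subrK.
have cost : (transport_cost N Y gamma <= e%:E)%E.
  rewrite /transport_cost.
  under eq_bigr => j _.
    rewrite /gamma integral_two_diracs/=; last exact: measurable_norm_sub.
    rewrite subrr is_norm0// mulr0 add0r.
    over.
  rewrite sumEFin lee_fin sum_b /t.
  have [->|Nz] := eqVneq (N (z - Y i)) 0; first by rewrite mulr0.
  by rewrite divfK.
apply: ereal_sup_ubound; exists gamma => //.
rewrite integral_sum_measure; last 2 first.
- exact: integrable_growth mass cost.
- exact/measurable_EFinP.
under eq_bigr => j _ do rewrite /gamma integral_two_diracs//=.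
rewrite sumEFin; congr EFin.
(* Regrouped as the nominal term plus moved mass times increment of [f], so that [sum_b] keeps only
   the gain at [i]. *)
under eq_bigr => j _.
  rewrite (_ : _ + _ = p j * f (Y j) + b j * (f z - f (Y j))); last by ring.
  over.
rewrite big_split/= sum_b; congr (_ + _).
rewrite /slope /t; case: eqP => [->|_].
  by rewrite (subrr (f _)) mulr0 mul0r.
by rewrite [LHS]mulrAC [RHS]mulrAC [e * _]mulrC.
Qed.

(** With no budget any nonnegative growth constant gives the upper bound; [|L|] is taken because the
    sign of [L] is not assumed. The lower bound uses the competitor that moves nothing. *)
Lemma Vw0 (i : 'I_n) : Vw N Y p f 0 = nominal%:E.
Proof.
apply/eqP; rewrite eq_le; apply/andP; split.
  rewrite -[nominal]addr0 -[X in _ + X](mulr0 `|L|).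
  apply: Vw_le => // j z; rewrite -lerBlDl.
  apply: le_trans (ler_norm _) _; apply: le_trans (f_growth z j) _.
  by rewrite ler_wpM2r ?is_norm_ge0// ler_norm.
have := @Vw_ge 0 i (Y i) (lexx 0); rewrite mulr0 addr0 mul0r; apply.
exact/ltW.
Qed.

Lemma slope_le i z : slope N Y f i z <= `|L|.
Proof.
rewrite /slope; case: eqP => [//|/eqP zY].
rewrite ler_pdivrMr; last by rewrite is_norm_gt0// subr_eq0.
apply: le_trans (ler_norm _) _; apply: le_trans (f_growth z i) _.
by rewrite ler_wpM2r ?is_norm_ge0// ler_norm.
Qed.

(** Through this convention every upper bound of the slopes is nonnegative, as [Vw_le] requires. *)
Lemma slope_center i : slope N Y f i (Y i) = 0.
Proof. by rewrite /slope eqxx. Qed.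

Lemma le_slope (s : R) i z : slope N Y f i z <= s ->
  f z <= f (Y i) + s * N (z - Y i).
Proof.
rewrite /slope; case: eqP => [-> _|/eqP zY].
  by rewrite subrr is_norm0// mulr0 addr0.
by rewrite ler_pdivrMr ?is_norm_gt0 ?subr_eq0// lerBlDl.
Qed.

(** Away from [Y i], the moved mass fits into [p i] once [e <= p i * N (z - Y i)], a positive
    threshold; at [Y i] nothing is moved. *)
Lemma near_Vw_ge (i : 'I_n) (z : 'rV[R]_m) :
  \forall e \near 0^'+,
    ((nominal + slope N Y f i z * e)%:E <= Vw N Y p f e)%E.
Proof.
have [Nz|Nz] := eqVneq (N (z - Y i)) 0.
  near=> e; apply: Vw_ge; first by near: e; exact: nbhs_right_ge.
  by rewrite Nz invr0 mulr0 ltW.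
have N0 : 0 < N (z - Y i) by rewrite lt0r Nz is_norm_ge0.
near=> e; apply: Vw_ge; first by near: e; exact: nbhs_right_ge.
rewrite ler_pdivrMr//; near: e; apply: nbhs_right_le.
by rewrite mulr_gt0.
Unshelve. all: by end_near. Qed.

(** The supremum enters as a real number with its two defining properties, so that the estimates
    take place in the reals. *)
Lemma sensitivity_cvg (s : R) : (0 < n)%N ->
  (forall i z, slope N Y f i z <= s) ->
  (forall r, r < s -> exists i z, r < slope N Y f i z) ->
  ((Vw N Y p f e - Vw N Y p f 0) / e%:E)%E @[e --> 0^'+] --> s%:E.
Proof.
move=> n0 slope_s s_sup; pose i0 := Ordinal n0.
have s0 : 0 <= s by rewrite -(slope_center i0).
pose V e := fine (Vw N Y p f e).
(* The value is finite near zero: the competitor that moves nothing bounds it below, [Vw_le]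
   above. *)
have VE : \forall e \near 0^'+, (Vw N Y p f e = (V e)%:E)%E.
  have := near_Vw_ge i0 (Y i0); apply: filterS => e Vge.
  rewrite /V fineK// fin_numE; apply/andP; split.
    by rewrite -ltNye (lt_le_trans (ltNyr _) Vge).
  rewrite -ltey (le_lt_trans _ (ltry (nominal + s * e)))//.
  by apply: Vw_le => // i z; exact: le_slope.
apply: (@cvg_trans _ ((((V e - nominal) / e)%:E) @[e --> 0^'+])).
  apply: near_eq_cvg; near=> e.
  have e0 : 0 < e by near: e; exact: nbhs_right_gt.
  rewrite (Vw0 i0) (near VE e)//= -EFinB inver gt_eqF//.
apply: cvg_EFin; first exact: nearW.
apply/cvgrPdist_le => d d0.
(* For small [e] the quotient lies between this slope and [s]. *)
have [i [z dz]] : exists i z, s - d < slope N Y f i z.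
  by apply: s_sup; rewrite ltrBlDr ltrDl.
near=> e.
have e0 : 0 < e by near: e; exact: nbhs_right_gt.
have Vge : nominal + slope N Y f i z * e <= V e.
  rewrite -lee_fin -(near VE e)//; near: e; exact: near_Vw_ge.
have Vle : V e <= nominal + s * e.
  rewrite -lee_fin -(near VE e)//.
  by apply: Vw_le => // j x; exact: le_slope.
have q1 : slope N Y f i z <= (V e - nominal) / e.
  by rewrite ler_pdivlMr// lerBrDl.
have q2 : (V e - nominal) / e <= s by rewrite ler_pdivrMr// lerBlDl.
rewrite /= ler_norml; lra.
Unshelve. all: by end_near. Qed.

End growth.
End sensitivity.

Theorem proposition4p10 (R : realType) (m n : nat)
  (Y : 'I_n -> 'rV[R]_m) (p : 'I_n -> R)
  (p_gt0 : forall i, 0 < p i) (p_sum1 : \sum_(i < n) p i = 1)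
  (N : 'rV[R]_m -> R) (N_norm : is_norm N)
  (f : 'rV[R]_m -> R)
  (f_meas : measurable_fun [set: borel_rV R m] (f : borel_rV R m -> R))
  (L : R) (f_growth : forall z i, `|f z - f (Y i)| <= L * N (z - Y i)) :
  ((Vw N Y p f e - Vw N Y p f 0) / e%:E)%E @[e --> 0^'+] -->
  (\big[maxe/-oo]_(i < n) ereal_sup [set (slope N Y f i z)%:E | z in setT])%E.
Proof.
have n0 : (0 < n)%N.
  rewrite lt0n; apply/eqP => n0; move: p_sum1; subst n.
  by rewrite big_ord0 => /eqP; rewrite eq_sym oner_eq0.
set S := (\big[maxe/-oo]_(i < n) _)%E.
(* [S] is finite, being at least some slope and at most [|L|], so its real part can serve as [s]. *)
have slope_S i z : ((slope N Y f i z)%:E <= S)%E.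
  by apply: (bigmax_sup i) => //; apply: ereal_sup_ubound; exists z.
have S_fin : S \is a fin_num.
  rewrite fin_numE; apply/andP; split.
    by rewrite -ltNye (lt_le_trans (ltNyr _) (slope_S (Ordinal n0) 0)).
  rewrite -ltey (le_lt_trans _ (ltry `|L|))//; apply: bigmax_le => [|i _].
    exact: leNye.
  by apply: ub_ereal_sup => _ [z _ <-]; rewrite lee_fin slope_le.
rewrite -(fineK S_fin).
apply: (sensitivity_cvg _ _ _ _ _ _ _ p_gt0 N_norm f_meas L f_growth _ n0).
- by move=> i z; rewrite -lee_fin fineK.
- move=> r; rewrite -lte_fin fineK// => /bigmax_gtP[|[i _]].
    (* This case is the default [-oo] of the maximum, which exceeds no real. *)
    by rewrite ltNge leNye.
  by move=> /ereal_sup_gt[_ [z _ <-]]; rewrite lte_fin => ?; exists i, z.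
Qed.
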